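(* Let $\mathfrak g$ be a Lie algebra over $\mathbb K$ with Euler operator $E$. The following are equivalent: (1) The geometry given by $(\mathfrak g,E)$ is self-dual. (2) There is an involution $j$ of $(\mathfrak g,E)$ such that $j(V^+)\cap V^+\neq\emptyset$. (3) The Jordan pair $(V^+,V^-)$ contains invertible elements. (4) The Jordan pair $(V^+,V^-)$ comes from a unital Jordan algebra.
   Context: $\mathbb K$ is a commutative ring with unit in which $2,3$ are invertible. An Euler operator is $E\in\mathfrak g$ with $\mathrm{ad}(E)^3=\mathrm{ad}(E)$; put $\mathfrak g_i=\{X:[E,X]=iX\}$, $i=1,0,-1$, so $\mathfrak g=\mathfrak g_1\oplus\mathfrak g_0\oplus\mathfrak g_{-1}$ is a $3$-grading. Let $\mathfrak f^+$ be the flag $\mathfrak g_1\subset\mathfrak g_0\oplus\mathfrak g_1$ and $\mathfrak f^-$ the flag $\mathfrak g_{-1}\subset\mathfrak g_0\oplus\mathfrak g_{-1}$. For $x\in\mathfrak g_{\pm1}$, $e^{\mathrm{ad}\,x}=1+\mathrm{ad}\,x+\frac12(\mathrm{ad}\,x)^2\in\mathrm{Aut}(\mathfrak g)$; $G$ is the subgroup of $\mathrm{Aut}(\mathfrak g)$ generated by all these. Automorphisms act on flags of submodules of $\mathfrak g$. Put $X^+=G.\mathfrak f^-$, $X^-=G.\mathfrak f^+$. As sets of flags, $V^+=\{e^{\mathrm{ad}\,x}.\mathfrak f^-:x\in\mathfrak g_1\}\subset X^+$ and $V^-=\{e^{\mathrm{ad}\,y}.\mathfrak f^+:y\in\mathfrak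 g_{-1}\}\subset X^-$; these are identified with $\mathfrak g_1$, $\mathfrak g_{-1}$ via $x\mapsto e^{\mathrm{ad}\,x}.\mathfrak f^{\mp}$ (injective maps). The geometry is self-dual if $X^+=X^-$ and $V^+\cap V^-\neq\emptyset$ (intersection as sets of flags). An involution of $(\mathfrak g,E)$ is a Lie algebra automorphism $j$ with $j\circ j=\mathrm{id}$, $j(\mathfrak g_{\pm1})=\mathfrak g_{\mp1}$, $j(\mathfrak g_0)=\mathfrak g_0$; in (2), $j$ acts on flags and $V^+$ is regarded as a set of flags. The Jordan pair of $(\mathfrak g,E)$ is $(V^+,V^-)=(\mathfrak g_1,\mathfrak g_{-1})$ with the trilinear maps $T^\pm(X,Y,Z)=-[[X,Y],Z]$, $T^\pm:V^\pm\times V^\mp\times V^\pm\to V^\pm$. With $Q^\pm(x)v=\frac12[x,[x,v]]$ ($x\in V^\pm$, $v\in V^\mp$), an element $x\in V^\pm$ is invertible if $Q^\pm(x):V^\mp\to V^\pm$ is bijective. The Jordan pair of a unital (linear) Jordan algebra $(J,\cdot)$ over $\mathbb K$ is $(J,J)$ with $T^\pm(x,y,z)=2\big((x\cdot y)\cdot z+x\cdot(y\cdot z)-y\cdot(x\cdot z)\big)$; (4) means that $(V^+,V^-)$ is isomorphic as a Jordan pair (pair of linear bijections compatible with $T^\pm$) to the Jordan pair of some unital Jordan algebra. *)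

(* Defs.v *)
From HB Require Import structures.
From mathcomp Require Import all_boot all_order all_algebra.
From mathcomp Require Import all_classical.

Set Implicit Arguments.
Unset Strict Implicit.
Unset Printing Implicit Defensive.

Import GRing.Theory.
Local Open Scope ring_scope.
Local Open Scope classical_set_scope.

HB.mixin Record Lmodule_isLieAlgebra (K : comPzRingType) (g : Type)
    of GRing.Lmodule K g := {
  lie : g -> g -> g;
  lie_linearl : forall y : g, linear (fun x : g => lie x y);
  lie_linearr : forall x : g, linear (fun y : g => lie x y);
  liexx : forall x : g, lie x x = 0;
  lie_jacobi : forall x y z : g,
    lie x (lie y z) + lie y (lie z x) + lie z (lie x y) = 0
}.

#[short(type="lieAlgType")]
HB.structure Definition LieAlgebra (K : comPzRingType) :=
  {g of GRing.Lmodule K g & Lmodule_isLieAlgebra K g}.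

(* The case 0 = [jone] is allowed: the zero module is a unital Jordan algebra. *)
HB.mixin Record Lmodule_isUnitalJordanAlgebra (K : comPzRingType) (J : Type)
    of GRing.Lmodule K J := {
  jmul : J -> J -> J;
  jone : J;
  jmul_linearl : forall y : J, linear (fun x : J => jmul x y);
  jmulC : commutative jmul;
  jmul1 : left_id jone jmul;
  jmul_jordan : forall x y : J,
    jmul x (jmul (jmul x x) y) = jmul (jmul x x) (jmul x y)
}.

#[short(type="unitalJordanAlgType")]
HB.structure Definition UnitalJordanAlgebra (K : comPzRingType) :=
  {J of GRing.Lmodule K J & Lmodule_isUnitalJordanAlgebra K J}.

Definition jordan_triple (K : comPzRingType) (J : unitalJordanAlgType K)
    (x y z : J) : J :=
  (jmul (jmul x y) z + jmul x (jmul y z) - jmul y (jmul x z)) *+ 2.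

(* The subgroup generated by [S] in the group of bijections of [T]. *)
Inductive generated_group (T : Type) (S : set (T -> T)) : set (T -> T) :=
| gen_in f : S f -> generated_group S f
| gen_id : generated_group S id
| gen_comp f h : generated_group S f -> generated_group S h ->
    generated_group S (f \o h)
| gen_inv f h : generated_group S f -> cancel f h -> cancel h f ->
    generated_group S h.

Section ThreeGradedLieAlgebra.
Variables (K : comUnitRingType) (g : lieAlgType K).
Implicit Types (E x y z : g) (f : g -> g).

Definition ad x : g -> g := lie x.

Definition euler_operator E : Prop := forall x, ad E (ad E (ad E x)) = ad E x.

(* [grade E i] is g_i for i = 1, 0, -1 in K. *)
Definition grade E (i : K) : set g := [set x | lie E x = i *: x].

Definition exp_ad x : g -> g :=
  fun y => y + ad x y + (2%:R : K)^-1 *: ad x (ad x y).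

Definition lie_automorphism f : Prop :=
  [/\ linear f, bijective f & {morph f : x y / lie x y}].

Definition elementary_group E : set (g -> g) :=
  generated_group [set exp_ad x | x in grade E 1 `|` grade E (- 1)].

(* A flag F1 <= F2 of submodules of g is encoded by the pair (F1, F2) of its
   underlying sets; all flags used below are images of [flag_plus E] and
   [flag_minus E] under automorphisms. *)
Definition flag : Type := (set g * set g)%type.

Definition flag_plus E : flag :=
  (grade E 1, [set x + y | x in grade E 0 & y in grade E 1]).

Definition flag_minus E : flag :=
  (grade E (- 1), [set x + y | x in grade E 0 & y in grade E (- 1)]).

Definition flag_act f (F : flag) : flag := (f @` F.1, f @` F.2).

Definition X_plus E : set flag :=
  [set flag_act f (flag_minus E) | f in elementary_group E].

Definition X_minus E : set flag :=
  [set flag_act f (flag_plus E) | f in elementary_group E].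

Definition V_plus E : set flag :=
  [set flag_act (exp_ad x) (flag_minus E) | x in grade E 1].

Definition V_minus E : set flag :=
  [set flag_act (exp_ad y) (flag_plus E) | y in grade E (- 1)].

Definition self_dual E : Prop :=
  X_plus E = X_minus E /\ V_plus E `&` V_minus E !=set0.

Definition graded_involution E f : Prop :=
  [/\ lie_automorphism f, involutive f,
      f @` grade E 1 = grade E (- 1), f @` grade E (- 1) = grade E 1
    & f @` grade E 0 = grade E 0].

(* T^+ and T^- are the restrictions of [lie_triple] to
   g_1 x g_(-1) x g_1 and g_(-1) x g_1 x g_(-1). *)
Definition lie_triple x y z : g := - lie (lie x y) z.

Definition lie_quad x : g -> g := fun v => (2%:R : K)^-1 *: lie x (lie x v).

Definition invertible_plus E x : Prop :=
  grade E 1 x /\ set_bij (grade E (- 1)) (grade E 1) (lie_quad x).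

Definition invertible_minus E y : Prop :=
  grade E (- 1) y /\ set_bij (grade E 1) (grade E (- 1)) (lie_quad y).

(* An isomorphism from the Jordan pair (J, J) onto (g_1, g_(-1)), given as two
   linear maps into g that are bijective onto g_1 and g_(-1). *)
Definition jordan_pair_iso E (J : unitalJordanAlgType K)
    (hp hm : {linear J -> g}) : Prop :=
  [/\ set_bij setT (grade E 1) hp,
      set_bij setT (grade E (- 1)) hm,
      forall x y z : J,
        hp (jordan_triple x y z) = lie_triple (hp x) (hm y) (hp z)
    & forall x y z : J,
        hm (jordan_triple x y z) = lie_triple (hm x) (hp y) (hm z)].

End ThreeGradedLieAlgebra.

(* Main.v *)
Require Import Defs.
From HB Require Import structures.
From mathcomp Require Import all_boot all_order all_algebra.
From mathcomp Require Import all_classical.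

Set Implicit Arguments.
Unset Strict Implicit.
Unset Printing Implicit Defensive.

Import GRing.Theory.
Local Open Scope ring_scope.
Local Open Scope classical_set_scope.

(** The whole theorem is carried by one notion: a pair (x, y) in g_1 x g_(-1)
    with ad [x, y] = 2 ad E ([inverse_pair]).  Then x, [x, y], y span an
    sl_2-triple inducing the given grading, and y = - Q(x)^(-1) x is, up to
    sign, the Jordan inverse of x.  Each of the four conditions is equivalent to
    the existence of such a pair.

    An invertible x has a partner y ([invertible_inverse_pair]): solve
    Q(x) y = - x; the relation [ad(x)^3, ad(y)] = 0 then forces [x, y] to act as
    2 ad E.  Conversely, Q(x) and Q(y) are inverse to each other for any inverse
    pair.

    From an inverse pair one gets w = e^(ad x) e^(- ad y) e^(ad x), the Weyl
    element of the triple.  It is an involution of (g, E), equal to Q(x) on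
    g_(-1) and to Q(y) on g_1 ([weyl_graded_involution]).  As w exchanges the
    two base flags and e^(ad x) fixes f^+, it follows that
    e^(ad x) f^- = e^(ad y) f^+; so V^+ meets V^-, and f^- and f^+ lie in one
    orbit of G ([inverse_pair_self_dual]).

    Conversely, if e^(ad x) f^- = e^(ad y) f^+, comparing the smallest pieces
    degree by degree gives Q(y) Q(x) = id and Q(x) Q(y) = id, so x is invertible
    ([V_meet_invertible]).  Since every involution j of (g, E) maps V^+ onto V^-
    ([graded_involution_V]), the condition on j says exactly that V^+ meets V^-.

    Finally, for an inverse pair the product a.b = [[a, y], b] / 2 makes g_1 a
    Jordan algebra with unit x.  Its Jordan identity is a computation in g
    ([jordan_commute]); the inclusion of g_1 and its composite with w identify
    its Jordan pair with that of (g, E), because w is a Lie algebra automorphism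
    ([homotope_pair_iso]).  In the other direction the image of the unit is
    invertible, as the quadratic operator of a unit is the identity
    ([jordan_pair_iso_invertible]).

    The situation is symmetric under replacing E by - E, which exchanges g_1 and
    g_(-1); most statements are proved for one sign only. *)

(** * Linear and set-theoretic preliminaries *)

Section Preliminaries.
Variables (K : comUnitRingType) (V : lmodType K).

Lemma halfK (two_unit : (2%:R : K) \is a GRing.unit) (a : V) :
  (2%:R : K)^-1 *: (a *+ 2) = a.
Proof. by rewrite -scaler_nat scalerA mulVr // scale1r. Qed.

Lemma mulrn_unit_eq0 n (n_unit : (n%:R : K) \is a GRing.unit) (a : V) :
  a *+ n = 0 -> a = 0.
Proof.
rewrite -scaler_nat => na0.
by rewrite -[a]scale1r -(mulVr n_unit) -scalerA na0 scaler0.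
Qed.

Lemma linear_image_sum (j : V -> V) (A B : set V) : linear j ->
  j @` [set a + b | a in A & b in B] = [set a + b | a in j @` A & b in j @` B].
Proof.
move=> jlin; have jD a b : j (a + b) = j a + j b.
  by have := jlin 1 a b; rewrite !scale1r.
apply/seteqP; split=> [_ [_ [a Aa [b Bb <-]] <-]|].
  by rewrite jD; exists (j a); [exists a | exists (j b); [exists b|]].
move=> _ [_ [a Aa <-] [_ [b Bb <-] <-]].
by rewrite -jD; exists (a + b) => //; exists a => //; exists b.
Qed.

End Preliminaries.

Lemma involutive_image (T : Type) (j : T -> T) (A B : set T) : involutive j ->
  (forall t, A t -> B (j t)) -> (forall t, B t -> A (j t)) -> j @` A = B.
Proof.
move=> jj AB BA; apply/seteqP; split=> [_ [t At <-]|t Bt]; first exact: AB.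
by exists (j t); [apply: BA | apply: jj].
Qed.

(** * Lie algebra identities *)

Section LieIdentities.
Variables (K : comPzRingType) (g : lieAlgType K).
Implicit Types x y z : g.

Lemma lieDr x y z : lie x (y + z) = lie x y + lie x z.
Proof. by have := lie_linearr x 1 y z; rewrite !scale1r. Qed.

Lemma lie0r x : lie x 0 = 0.
Proof. by apply: (addrI (lie x 0)); rewrite -lieDr !addr0. Qed.

Lemma lieZr (k : K) x y : lie x (k *: y) = k *: lie x y.
Proof. by have := lie_linearr x k y 0; rewrite !addr0 lie0r addr0. Qed.

Lemma lieNr x y : lie x (- y) = - lie x y.
Proof. by rewrite -!scaleN1r lieZr. Qed.

Lemma lieBr x y z : lie x (y - z) = lie x y - lie x z.
Proof. by rewrite lieDr lieNr. Qed.

Lemma lieMnr x y n : lie x (y *+ n) = lie x y *+ n.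
Proof. by rewrite -!scaler_nat lieZr. Qed.

Lemma lieC x y : lie x y = - lie y x.
Proof.
have lieDl a b c : lie (a + b) c = lie a c + lie b c :> g.
  by have := lie_linearl c 1 a b; rewrite !scale1r.
apply/eqP; rewrite -addr_eq0; apply/eqP.
by have := liexx (x + y); rewrite lieDl !lieDr /= !liexx add0r addr0 addrC.
Qed.

Lemma lieDl x y z : lie (x + y) z = lie x z + lie y z.
Proof. by rewrite lieC lieDr opprD (lieC x) (lieC y). Qed.

Lemma lieNl x y : lie (- x) y = - lie x y.
Proof. by rewrite lieC lieNr (lieC x). Qed.

Lemma lieZl (k : K) x y : lie (k *: x) y = k *: lie x y.
Proof. by rewrite lieC lieZr (lieC x) scalerN. Qed.

Lemma lieMnl x y n : lie (x *+ n) y = lie x y *+ n.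
Proof. by rewrite lieC lieMnr (lieC x) mulNrn. Qed.

Lemma lie0l x : lie 0 x = 0.
Proof. by rewrite lieC lie0r oppr0. Qed.

Lemma lie_leibniz x y z : lie x (lie y z) = lie (lie x y) z + lie y (lie x z).
Proof.
have /eqP := lie_jacobi x y z; rewrite -addrA addr_eq0 => /eqP ->.
by rewrite (lieC z x) lieNr (lieC z) opprD !opprK addrC.
Qed.

End LieIdentities.

(** * Eigenspaces of ad E *)

Section Gradings.
Variables (K : comUnitRingType) (g : lieAlgType K).
Implicit Types (E x y z t : g) (i j k : K).

Lemma grade1E E x : grade E 1 x <-> lie E x = x.
Proof. by rewrite /grade /= scale1r. Qed.

Lemma gradeN1E E x : grade E (- 1) x <-> lie E x = - x.
Proof. by rewrite /grade /= scaleN1r. Qed.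

Lemma grade0E E x : grade E 0 x <-> lie E x = 0.
Proof. by rewrite /grade /= scale0r. Qed.

Lemma gradeN E i : grade (- E) i = grade E (- i).
Proof.
rewrite /grade; apply/seteqP; split=> x /=; rewrite lieNl scaleNr.
  by move=> <-; rewrite opprK.
by move=> ->; rewrite opprK.
Qed.

Lemma euler_operatorN E : euler_operator E -> euler_operator (- E).
Proof.
move=> hE x; rewrite /ad !lieNl !lieNr /= opprK; congr (- _).
exact: hE.
Qed.

Lemma grade_addr_closed E i x y :
  grade E i x -> grade E i y -> grade E i (x + y).
Proof. by rewrite /grade /= lieDr scalerDr => -> ->. Qed.

Lemma grade_scaler_closed E i k x : grade E i x -> grade E i (k *: x).
Proof. by rewrite /grade /= lieZr /= => ->; rewrite !scalerA mulrC. Qed.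

Lemma grade_oppr_closed E i x : grade E i x -> grade E i (- x).
Proof. by rewrite -scaleN1r; apply: grade_scaler_closed. Qed.

Lemma grade_lie E i j k x y :
  grade E i x -> grade E j y -> i + j = k -> grade E k (lie x y).
Proof.
rewrite /grade /= lie_leibniz => -> -> <-.
by rewrite lieZl lieZr scalerDl.
Qed.

Lemma grade_lie0 E x y : grade E 1 x -> grade E (- 1) y -> grade E 0 (lie x y).
Proof. by move=> gx gy; apply: grade_lie gx gy _; rewrite subrr. Qed.

Lemma grade_lie0_sym E x y :
  grade E (- 1) x -> grade E 1 y -> grade E 0 (lie x y).
Proof. by move=> gx gy; apply: grade_lie gx gy _; rewrite addrC subrr. Qed.

Lemma grade_liel E i x z : grade E i x -> grade E 0 z -> grade E i (lie x z).
Proof. by move=> gx gz; apply: grade_lie gx gz _; rewrite addr0. Qed.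

Lemma grade_lier E i x z : grade E 0 z -> grade E i x -> grade E i (lie z x).
Proof. by move=> gz gx; apply: grade_lie gz gx _; rewrite add0r. Qed.

End Gradings.

(** * The 3-grading of an Euler operator *)

Section ThreeGrading.
Variables (K : comUnitRingType) (g : lieAlgType K).
Hypothesis two_unit : (2%:R : K) \is a GRing.unit.
Hypothesis three_unit : (3%:R : K) \is a GRing.unit.
Implicit Types (E x y z t u v : g).

Local Notation half := ((2%:R : K)^-1).

(** The bracket has ad E-eigenvalue 2, while ad E only admits roots of
    T^3 = T; hence 6 [x, y] = 0. *)
Lemma grade_lie11 E x y (hE : euler_operator E) :
  grade E 1 x -> grade E 1 y -> lie x y = 0.
Proof.
move=> gx gy; have : grade E (1 + 1) (lie x y) by apply: grade_lie gx gy _.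
set w := lie x y => gw; apply: (mulrn_unit_eq0 two_unit).
apply: (mulrn_unit_eq0 three_unit).
have Ew : lie E w = w *+ 2 by rewrite gw scalerDl scale1r.
have := hE w; rewrite /ad Ew lieMnr /= Ew !lieMnr /= Ew -!mulrnA.
rewrite (_ : (2 * (2 * 2) = 2 + 2 * 3)%N) // mulrnDr => /eqP.
by rewrite -subr_eq0 addrAC subrr add0r => /eqP.
Qed.

Lemma grade_lieN1N1 E x y (hE : euler_operator E) :
  grade E (- 1) x -> grade E (- 1) y -> lie x y = 0.
Proof. by rewrite -!gradeN; apply/grade_lie11/euler_operatorN. Qed.

(** The three components are the values at t of the interpolation projectors
    (A^2 + A) / 2, 1 - A^2 and (A^2 - A) / 2 of A = ad E. *)
Lemma grade_decomposition E t (hE : euler_operator E) :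
  exists u z v,
    [/\ grade E 1 u, grade E 0 z, grade E (- 1) v & t = z + (u + v)].
Proof.
set s := lie E t; set r := lie E s.
have Er : lie E r = s by apply: hE.
exists (half *: (r + s)), (t - r), (half *: (r - s)); split.
- by apply: grade_scaler_closed; apply/grade1E; rewrite lieDr Er addrC.
- by apply/grade0E; rewrite lieBr Er subrr.
- by apply: grade_scaler_closed; apply/gradeN1E; rewrite lieBr Er opprB.
- by rewrite -scalerDr addrACA subrr addr0 -mulr2n halfK // subrK.
Qed.

Lemma graded_ind (P : g -> Prop) E (hE : euler_operator E) :
    (forall s t, P s -> P t -> P (s + t)) ->
    (forall u, grade E 1 u -> P u) -> (forall z, grade E 0 z -> P z) ->
    (forall v, grade E (- 1) v -> P v) ->
  forall t, P t.
Proof.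
move=> PD P1 P0 PN t.
have [u [z [v [gu gz gv ->]]]] := grade_decomposition t hE.
by apply: (PD); [apply: P0 | apply: (PD); [apply: P1 | apply: PN]].
Qed.

(** ad x raises the degree by one and the grading has length three. *)
Lemma ad_cube1 E x t (hE : euler_operator E) :
  grade E 1 x -> lie x (lie x (lie x t)) = 0.
Proof.
move=> gx; move: t; apply: (graded_ind hE) => [s t IHs IHt|u gu|z gz|v gv].
- by rewrite !lieDr /= IHs IHt addr0.
- by rewrite (grade_lie11 hE gx gu) !lie0r.
- by rewrite (grade_lie11 hE gx (grade_liel gx gz)) lie0r.
- by rewrite (grade_lie11 hE gx (grade_liel gx (grade_lie0 gx gv))).
Qed.

Lemma ad_cube E x t (hE : euler_operator E) :
  grade E 1 x \/ grade E (- 1) x -> lie x (lie x (lie x t)) = 0.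
Proof.
case=> gx; first exact: ad_cube1 hE gx.
by apply: (ad_cube1 _ (euler_operatorN hE)); rewrite gradeN.
Qed.

(** * Exponentials of nilpotent derivations *)

Lemma exp_ad_linear x : linear (@exp_ad K g x).
Proof.
move=> k a b; rewrite /exp_ad /ad !lieDr !lieZr !scalerDr.
rewrite [half *: (k *: _)]scalerA [half * k]mulrC -scalerA.
by rewrite (addrACA (k *: a)) (addrACA (k *: a + _)).
Qed.

HB.instance Definition _ x :=
  GRing.isLinear.Build K g g *:%R (@exp_ad K g x) (exp_ad_linear x).

Lemma exp_adK x : (forall t, lie x (lie x (lie x t)) = 0) ->
  cancel (@exp_ad K g x) (@exp_ad K g (- x)).
Proof.
move=> x3 t; rewrite /exp_ad /ad !lieNl lieNr opprK !lieDr !lieZr !x3.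
rewrite lie0r !scaler0 !addr0; set r := lie x (lie x t).
rewrite addrAC -(addrA (t + _)) -scalerDr -mulr2n halfK //.
by rewrite -(addrA t) addrK.
Qed.

(** For a derivation D with D^3 = 0, the defects of multiplicativity of exp D
    are the terms of degree 3 and 4 in D.  They vanish because
    D^3 [a, b] = 3 ([D^2 a, D b] + [D a, D^2 b]), and applying D once more
    leaves 2 [D^2 a, D^2 b]. *)
Lemma exp_ad_lie x : (forall t, lie x (lie x (lie x t)) = 0) ->
  {morph @exp_ad K g x : a b / lie a b}.
Proof.
move=> x3 a b; rewrite /exp_ad /ad.
have [a1 xa] : exists c, lie x a = c by exists (lie x a).
have [a2 xa1] : exists c, lie x a1 = c by exists (lie x a1).
have [b1 xb] : exists c, lie x b = c by exists (lie x b).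
have [b2 xb1] : exists c, lie x b1 = c by exists (lie x b1).
have xa2 : lie x a2 = 0 by rewrite -xa1 -xa x3.
have xb2 : lie x b2 = 0 by rewrite -xb1 -xb x3.
have L1 : lie x (lie a b) = lie a1 b + lie a b1 by rewrite lie_leibniz xa xb.
have L2 : lie x (lie x (lie a b)) = lie a2 b + lie a1 b1 *+ 2 + lie a b2.
  rewrite L1 lieDr (lie_leibniz x a1) (lie_leibniz x a b1) xa xa1 xb xb1.
  by rewrite mulr2n !addrA.
have L3 : lie a2 b1 + lie a1 b2 = 0.
  apply: (mulrn_unit_eq0 three_unit).
  rewrite -(x3 (lie a b)) L2 mulr2n !lieDr.
  rewrite (lie_leibniz x a2) !(lie_leibniz x a1) (lie_leibniz x a).
  rewrite xa xb xa1 xb1 xa2 xb2 !lie0l !lie0r add0r addr0.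
  by rewrite mulrS mulr2n [RHS]addrAC.
have L4 : lie a2 b2 = 0.
  apply: (mulrn_unit_eq0 two_unit).
  have := congr1 (lie x) L3.
  rewrite lie0r lieDr (lie_leibniz x a2) (lie_leibniz x a1) xa2 xb1 xa1 xb2.
  by rewrite lie0l lie0r add0r addr0 -mulr2n.
rewrite !(xa, xb, xa1, xb1) L2 L1 !lieDl !lieDr !lieZl !lieZr L4 !scaler0 addr0.
rewrite mulr2n !scalerDr -scalerDr -mulr2n halfK //.
rewrite [RHS](AC (3*3*2) (1*(4*2)*(7*5*3)*(8*6))) /=.
by rewrite -[X in _ = _ + X]scalerDr L3 scaler0 addr0.
Qed.

(** * Invertible elements and sl_2-triples *)

(** The relation is imposed on ad [x, y] because E is determined by its grading
    only up to the centre of g; in this form it is symmetric under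
    (E, x, y) -> (- E, y, x). *)
Definition inverse_pair E x y : Prop :=
  [/\ grade E 1 x, grade E (- 1) y &
      forall t, lie (lie x y) t = lie E t *+ 2].

Lemma inverse_pairC E x y : inverse_pair E x y -> inverse_pair (- E) y x.
Proof.
case=> gx gy hxy; split; rewrite ?gradeN ?opprK // => t.
by rewrite (lieC y x) !lieNl hxy mulNrn.
Qed.

Lemma inverse_pairN E x y : inverse_pair E x y -> inverse_pair E (- x) (- y).
Proof.
case=> gx gy hxy; split=> [||t]; try exact: grade_oppr_closed.
by rewrite lieNl lieNr opprK.
Qed.

Lemma inverse_pair_lie1 E x y u (hE : euler_operator E) :
  inverse_pair E x y -> grade E 1 u -> lie x (lie y u) = u *+ 2.
Proof.
case=> gx gy hxy gu.
rewrite lie_leibniz hxy (grade_lie11 hE gx gu) lie0r addr0.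
by rewrite (iffLR (grade1E _ _) gu).
Qed.

Lemma inverse_pair_lieN1 E x y v (hE : euler_operator E) :
  inverse_pair E x y -> grade E (- 1) v -> lie y (lie x v) = v *+ 2.
Proof.
move=> /inverse_pairC hyx; rewrite -gradeN.
exact: inverse_pair_lie1 (euler_operatorN hE) hyx.
Qed.

Lemma inverse_pair_lie_quad E x y v (hE : euler_operator E) :
  inverse_pair E x y -> grade E (- 1) v -> lie y (lie_quad x v) = lie x v.
Proof.
move=> hxy gv; have [gx gy hyx] := hxy; rewrite lieZr.
rewrite lie_leibniz (lieC y x) lieNl hyx (inverse_pair_lieN1 hE hxy gv).
rewrite (iffLR (grade0E _ _) (grade_lie0 gx gv)) mul0rn oppr0 add0r.
by rewrite lieMnr halfK.
Qed.

Lemma inverse_pair_quadK E x y v (hE : euler_operator E) :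
  inverse_pair E x y -> grade E (- 1) v -> lie_quad y (lie_quad x v) = v.
Proof.
move=> hxy gv; rewrite {1}/lie_quad (inverse_pair_lie_quad hE hxy gv).
by rewrite (inverse_pair_lieN1 hE hxy gv) halfK //.
Qed.

Lemma grade_quad E x v :
  grade E 1 x -> grade E (- 1) v -> grade E 1 (lie_quad x v).
Proof.
move=> gx gv; apply: grade_scaler_closed.
by apply: (grade_liel gx); apply: grade_lie0.
Qed.

Lemma grade_quad_sym E y u :
  grade E (- 1) y -> grade E 1 u -> grade E (- 1) (lie_quad y u).
Proof.
by move=> gy gu; rewrite -gradeN; apply: grade_quad; rewrite gradeN ?opprK.
Qed.

(** Write h = [x, y] with Q(x) y = - x, so that [h, x] = 2x.  For v in g_(-1),
    expanding [y, ad(x)^3 v] = 0 gives 3 ad(x)^2 ([h, v] + 2v) = 0, and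
    injectivity of Q(x) yields [h, v] = - 2v; surjectivity transports this to
    [h, u] = 2u on g_1.  For z in g_0, d = [h, z] satisfies [x, d] = 0 because
    [x, z] lies in g_1, and 2d = [y, [x, d]]. *)
Lemma invertible_inverse_pair E x (hE : euler_operator E) :
  invertible_plus E x -> exists y, inverse_pair E x y.
Proof.
case=> gx [_ Qinj Qsurj]; have gNx := grade_oppr_closed gx.
have [y gy Qxy] := Qsurj _ gNx.
have xh : lie x (lie x y) = - (x *+ 2).
  by rewrite -mulNrn -Qxy /lie_quad scalerMnr halfK.
pose h := lie x y; have g0h : grade E 0 h by apply: grade_lie0.
have hx : lie h x = x *+ 2 by rewrite lieC xh opprK.
have yx w : lie y (lie x w) = lie x (lie y w) - lie h w.
  by rewrite (lie_leibniz x) addrC addKr.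
have h1 w : lie h (lie x w) = lie x w *+ 2 + lie x (lie h w).
  by rewrite lie_leibniz hx lieMnl.
have hN1 v : grade E (- 1) v -> lie h v = - (v *+ 2).
  move=> gv; apply: Qinj; rewrite ?inE //.
  - exact: grade_lier.
  - by rewrite -mulNrn -scaler_nat; apply/grade_scaler_closed/grade_oppr_closed.
  rewrite /lie_quad; congr (_ *: _); rewrite !lieNr !lieMnr.
  set W := lie x (lie x v); set A := lie x (lie x (lie h v)).
  (* Two evaluations of [h, W]: moving h to the right, and [x, y] expanded. *)
  have hW1 : lie h W = W *+ 4 + A.
    by rewrite /W !h1 lieDr lieMnr addrA -mulrnDr.
  have yv0 : lie y v = 0.
    exact: (grade_lieN1N1 hE).
  have hW2 : lie h W = - (A + (W *+ 2 + A)).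
    have /eqP := yx W.
    rewrite (ad_cube1 v hE gx) lie0r eq_sym subr_eq0 => /eqP <-.
    by rewrite /W !yx yv0 lie0r sub0r lieBr h1 lieDr lieMnr !lieNr !opprD.
  apply/eqP; rewrite -addr_eq0; apply/eqP/(mulrn_unit_eq0 three_unit).
  transitivity (W *+ 4 + A + (A + (W *+ 2 + A))).
    rewrite mulrnDl -mulrnA [RHS](AC (2*(1*2)) ((2*(3*5))*(1*4))) /=.
    by rewrite -mulr2n -mulrS -mulrnDr.
  by rewrite -hW1 hW2 addNr.
have h1u u : grade E 1 u -> lie h u = u *+ 2.
  move=> gu; have [v gv <-] := Qsurj _ gu; rewrite /lie_quad lieZr !h1 hN1 //.
  by rewrite lieNr lieMnr subrr lie0r addr0 scalerMnr.
exists y; split=> //.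
apply: (graded_ind hE) => [s t IHs IHt|u gu|z gz|v gv].
- by rewrite !lieDr IHs IHt mulrnDl.
- by rewrite h1u // (iffLR (grade1E _ _) gu).
- rewrite (iffLR (grade0E _ _) gz) mul0rn -/h; set d := lie h z.
  have xd : lie x d = 0.
    apply: (addrI (lie x z *+ 2)); rewrite -h1 addr0.
    exact/h1u/grade_liel.
  apply: (mulrn_unit_eq0 two_unit); rewrite -(lie0r y) -xd.
  have gyz : grade E (- 1) (lie y z) by apply: grade_liel.
  have -> : d = lie x (lie y z) - lie y (lie x z).
    by rewrite yx opprB addrCA subrr addr0.
  have yyz : lie y (lie y z) = 0.
    exact: (grade_lieN1N1 hE).
  have gxz : grade E 1 (lie x z) by apply: grade_liel.
  have xxz : lie x (lie x z) = 0 by apply: (grade_lie11 hE).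
  have xyxz : lie x (lie y (lie x z)) = lie x z *+ 2.
    have /eqP := yx (lie x z); rewrite xxz lie0r eq_sym subr_eq0 => /eqP ->.
    exact/h1u/grade_liel.
  rewrite mulrnBl !lieBr xyxz lieMnr; congr (_ - _).
  rewrite !yx h1 hN1 // yyz lie0r sub0r opprK lieNr !lieMnr.
  by rewrite subrr subr0.
- by rewrite hN1 // (iffLR (gradeN1E _ _) gv) mulNrn.
Qed.

(** * The involution attached to an inverse pair *)

Definition weyl x y : g -> g := exp_ad x \o exp_ad (- y) \o exp_ad x.

Lemma exp_ad_cancel E x (hE : euler_operator E) :
  grade E 1 x \/ grade E (- 1) x -> cancel (exp_ad x) (exp_ad (- x)).
Proof. by move=> gx; apply: exp_adK => t; apply: ad_cube hE gx. Qed.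

Lemma exp_ad_fix1 E x u (hE : euler_operator E) :
  grade E 1 x -> grade E 1 u -> exp_ad x u = u.
Proof.
move=> gx gu; rewrite /exp_ad /ad (grade_lie11 hE gx gu).
by rewrite lie0r scaler0 !addr0.
Qed.

(** Both sides have the same three components v, [x, v], Q(x) v: this is the
    coincidence of points of V^+ and V^- in its most concrete form. *)
Lemma exp_ad_swap E x y v (hE : euler_operator E) :
  inverse_pair E x y -> grade E (- 1) v -> exp_ad x v = exp_ad y (lie_quad x v).
Proof.
move=> hxy gv; rewrite /exp_ad /ad (inverse_pair_lie_quad hE hxy gv).
rewrite (inverse_pair_lieN1 hE hxy gv) halfK //.
by rewrite addrC [v + _]addrC addrA.
Qed.

Lemma weylN1 E x y v (hE : euler_operator E) :
  inverse_pair E x y -> grade E (- 1) v -> weyl x y v = lie_quad x v.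
Proof.
move=> hxy gv; have [gx gy _] := hxy.
rewrite /weyl /= (exp_ad_swap hE hxy gv) (exp_ad_cancel hE); last by right.
by apply: (exp_ad_fix1 hE) => //; apply: grade_quad.
Qed.

Lemma weyl1 E x y u (hE : euler_operator E) :
  inverse_pair E x y -> grade E 1 u -> weyl x y u = lie_quad y u.
Proof.
move=> hxy gu; have [gx gy _] := hxy.
rewrite /weyl /= (exp_ad_fix1 hE gx gu).
have hyx := inverse_pairC (inverse_pairN hxy).
rewrite (exp_ad_swap (euler_operatorN hE) hyx) ?gradeN ?opprK //.
rewrite -{1}[x]opprK (exp_ad_cancel hE); last by left; apply: grade_oppr_closed.
by rewrite /lie_quad !lieNl lieNr opprK.
Qed.

(** With z' = z - [y, [x, z]], the point is that e^(ad x) z = z + [x, z] equals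
    e^(ad y) (z' + [x, z]), and that [x, z'] = - [x, z]. *)
Lemma weyl0 E x y z (hE : euler_operator E) :
  inverse_pair E x y -> grade E 0 z -> weyl x y z = z - lie y (lie x z).
Proof.
move=> hxy gz; have [gx gy hyx] := hxy.
have gxz : grade E 1 (lie x z) by apply: grade_liel.
have gyz : grade E (- 1) (lie y z) by apply: grade_liel.
have xxz : lie x (lie x z) = 0 by apply: (grade_lie11 hE).
have yyz : lie y (lie y z) = 0.
  exact: (grade_lieN1N1 hE gy gyz).
have xyz : lie x (lie y z) = lie y (lie x z).
  by rewrite lie_leibniz hyx (iffLR (grade0E _ _) gz) mul0rn add0r.
have xyxz := inverse_pair_lie1 hE hxy gxz.
have yyxz : lie y (lie y (lie x z)) = lie y z *+ 2.
  by rewrite -xyz (inverse_pair_lieN1 hE hxy gyz).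
rewrite /weyl /=; set z' := z - lie y (lie x z).
have -> : exp_ad x z = exp_ad y (z' + lie x z).
  rewrite /exp_ad /ad xxz scaler0 addr0.
  rewrite [lie y (z' + _)](_ : _ = lie y (lie x z) - lie y z).
    rewrite lieBr yyxz yyz subr0 halfK // -[RHS]addrA subrK.
    by rewrite addrAC subrK.
  rewrite lieDr lieBr yyxz [LHS]addrC mulr2n opprD.
  by rewrite (addrA (lie y z)) subrr sub0r.
rewrite (exp_ad_cancel hE); last by right.
have xz' : lie x z' = - lie x z.
  by rewrite lieBr xyxz mulr2n opprD addrA subrr sub0r.
by rewrite /exp_ad /ad lieDr xz' xxz addr0 !lieNr xxz oppr0 scaler0 addr0 addrK.
Qed.

Lemma weyl_linear x y : linear (weyl x y).
Proof. by move=> k a b; rewrite /weyl /= !linearP. Qed.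

Lemma weyl_graded_involution E x y (hE : euler_operator E) :
  inverse_pair E x y -> graded_involution E (weyl x y).
Proof.
move=> hxy; have [gx gy hyx] := hxy.
have w1 u : grade E 1 u -> grade E (- 1) (weyl x y u).
  by move=> gu; rewrite (weyl1 hE hxy gu); apply: grade_quad_sym.
have wN1 v : grade E (- 1) v -> grade E 1 (weyl x y v).
  by move=> gv; rewrite (weylN1 hE hxy gv); apply: grade_quad.
have w0 z : grade E 0 z -> grade E 0 (weyl x y z).
  move=> gz; rewrite (weyl0 hE hxy gz); apply: (grade_addr_closed gz).
  by apply: grade_oppr_closed; apply: (grade_lie0_sym gy); apply: grade_liel.
have wD s t : weyl x y (s + t) = weyl x y s + weyl x y t.
  by have := weyl_linear x y 1 s t; rewrite !scale1r.
have ww : involutive (weyl x y).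
  apply: (graded_ind hE) => [s t IHs IHt|u gu|z gz|v gv].
  - by rewrite (wD s t) wD IHs IHt.
  - rewrite (weyl1 hE hxy gu) (weylN1 hE hxy); last exact: grade_quad_sym.
    apply: (inverse_pair_quadK (euler_operatorN hE) (inverse_pairC hxy)).
    by rewrite gradeN opprK.
  - rewrite (weyl0 hE hxy); last exact: w0.
    rewrite (weyl0 hE hxy gz) lieBr.
    rewrite (inverse_pair_lie1 hE hxy); last exact: grade_liel.
    by rewrite mulr2n opprD addrA subrr sub0r lieNr opprK subrK.
  - rewrite (weylN1 hE hxy gv) (weyl1 hE hxy); last exact: grade_quad.
    exact: inverse_pair_quadK hE hxy gv.
split=> //; try exact: involutive_image.
split; [exact: weyl_linear | exact: inv_bij|] => a b.
rewrite /weyl /= !exp_ad_lie // => t; apply: (ad_cube _ hE).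
- by left.
- by right; apply: grade_oppr_closed.
- by left.
Qed.

(** * The two families of flags *)

Lemma flag_act_comp (f h : g -> g) (F : flag g) :
  flag_act f (flag_act h F) = flag_act (f \o h) F.
Proof. by rewrite /flag_act /= !image_comp. Qed.

Lemma flag_act_cancel (f h : g -> g) (F : flag g) :
  cancel f h -> flag_act h (flag_act f F) = F.
Proof.
move=> fK; rewrite flag_act_comp (_ : h \o f = id); last exact/funext.
by case: F => A B; rewrite /flag_act /= !image_id.
Qed.

(** ad x maps each piece of f^+ into itself, and so does ad (- x). *)
Lemma exp_ad_flag_plus E x (hE : euler_operator E) :
  grade E 1 x -> flag_act (exp_ad x) (flag_plus E) = flag_plus E.
Proof.
have stable (A : set g) :
    (forall x, grade E 1 x -> forall t, A t -> A (exp_ad x t)) ->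
    grade E 1 x -> exp_ad x @` A = A.
  move=> stA gx; have gNx := grade_oppr_closed gx.
  apply/seteqP; split=> [_ [t At <-]|t At]; first exact: stA.
  exists (exp_ad (- x) t); first exact: stA.
  by rewrite -{1}[x]opprK (exp_ad_cancel hE) //; left.
move=> gx; rewrite /flag_act /flag_plus /=.
congr pair; apply: stable => // {gx}x gx t.
  by move=> gt; rewrite (exp_ad_fix1 hE gx gt).
move=> [z gz [u gu <-]]; have gxz : grade E 1 (lie x z) by apply: grade_liel.
exists z => //; exists (lie x z + u); first exact: grade_addr_closed.
rewrite /exp_ad /ad !lieDr (grade_lie11 hE gx gu) (grade_lie11 hE gx gxz).
by rewrite lie0r !addr0 scaler0 addr0 addrAC addrA.
Qed.

Lemma graded_involution_flag E j :
  graded_involution E j -> flag_act j (flag_minus E) = flag_plus E.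
Proof.
case=> -[jlin _ _] _ _ jN1 j0.
by rewrite /flag_act /= linear_image_sum // jN1 j0.
Qed.

(** Conjugating by j turns e^(ad x) into e^(ad (j x)), and j f^- = f^+. *)
Lemma graded_involution_V E j :
  graded_involution E j -> flag_act j @` V_plus E = V_minus E.
Proof.
move=> hj; have [[jlin _ jlie] _ j1 _ _] := hj.
rewrite /V_plus /V_minus -j1 !image_comp; apply: eq_imagel => x gx /=.
rewrite -(graded_involution_flag hj) !flag_act_comp; congr flag_act.
apply/funext => t /=; rewrite /exp_ad /ad -!jlie.
by rewrite addrC jlin addrC; have := jlin 1 t (lie x t); rewrite !scale1r => ->.
Qed.

Lemma grade_projection E u z v :
    grade E 1 u -> grade E 0 z -> grade E (- 1) v ->
  let s := v + z + u in
  half *: (lie E (lie E s) + lie E s) = u /\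
  half *: (lie E (lie E s) - lie E s) = v.
Proof.
move=> /grade1E Eu /grade0E Ez /gradeN1E Ev s.
have Es : lie E s = u - v by rewrite /s !lieDr Ez Ev Eu addr0 addrC.
rewrite Es lieBr Eu Ev opprK; split.
  by rewrite addrACA subrr addr0 -mulr2n halfK.
by rewrite opprB [u + v]addrC addrACA subrr addr0 -mulr2n halfK.
Qed.

Lemma cancel_quad_bij E x y : grade E 1 x -> grade E (- 1) y ->
    (forall v, grade E (- 1) v -> lie_quad y (lie_quad x v) = v) ->
    (forall u, grade E 1 u -> lie_quad x (lie_quad y u) = u) ->
  invertible_plus E x.
Proof.
move=> gx gy QyK QxK; split=> //; split.
- by move=> v gv; apply: grade_quad.
- by move=> v v'; rewrite !inE => gv gv' eqQ; rewrite -(QyK v) // eqQ QyK.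
- by move=> u gu; exists (lie_quad y u); [apply: grade_quad_sym | apply: QxK].
Qed.

(** The components of degree 1 and - 1 of the common element: on the left they
    are Q(x) v and v, on the right u and Q(y) u. *)
Lemma exp_ad_match E x y u v :
    grade E 1 x -> grade E (- 1) y -> grade E 1 u -> grade E (- 1) v ->
    exp_ad x v = exp_ad y u -> lie_quad x v = u /\ lie_quad y u = v.
Proof.
move=> gx gy gu gv; rewrite /exp_ad /ad.
rewrite -/(lie_quad x v) -/(lie_quad y u) => eqe.
have [E1 E2] := grade_projection (grade_quad gx gv) (grade_lie0 gx gv) gv.
have [E3 E4] :=
  grade_projection gu (grade_lie0_sym gy gu) (grade_quad_sym gy gu).
have eqs : v + lie x v + lie_quad x v = lie_quad y u + lie y u + u.
  by rewrite eqe addrC [u + _]addrC addrA.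
by split; [rewrite -E1 eqs E3 | rewrite -E4 -eqs E2].
Qed.

(** Only the smaller submodules e^(ad x) g_(-1) = e^(ad y) g_1 of the two flags
    matter. *)
Lemma V_meet_invertible E :
  V_plus E `&` V_minus E !=set0 -> exists x, invertible_plus E x.
Proof.
case=> _ [[x gx <-] [y gy /(congr1 fst) /= eqf]]; exists x.
have match1 v : grade E (- 1) v -> lie_quad y (lie_quad x v) = v.
  move=> gv; have : (exp_ad x @` grade E (- 1)) (exp_ad x v) by exists v.
  by rewrite -eqf => -[u gu] /esym /(exp_ad_match gx gy gu gv)[-> ->].
have match2 u : grade E 1 u -> lie_quad x (lie_quad y u) = u.
  move=> gu; have : (exp_ad y @` grade E 1) (exp_ad y u) by exists u.
  by rewrite eqf => -[v gv] /(exp_ad_match gx gy gu gv)[Qx ->].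
exact: cancel_quad_bij gx gy match1 match2.
Qed.

(** From w f^- = f^+ = e^(ad x) f^+, cancel the leftmost e^(ad x) of w. *)
Lemma inverse_pair_meet E x y (hE : euler_operator E) : inverse_pair E x y ->
  flag_act (exp_ad x) (flag_minus E) = flag_act (exp_ad y) (flag_plus E).
Proof.
move=> hxy; have [gx gy _] := hxy.
have := graded_involution_flag (weyl_graded_involution hE hxy).
rewrite -{1}(exp_ad_flag_plus hE gx) /weyl -!flag_act_comp.
move=> /(congr1 (flag_act (exp_ad (- x)))).
rewrite !(flag_act_cancel _ (exp_ad_cancel hE (or_introl gx))) => <-.
rewrite -{1}[y]opprK flag_act_cancel //.
by apply: (exp_ad_cancel hE); right; apply: grade_oppr_closed.
Qed.

(** The common point of V^+ and V^- also shows that f^- and f^+ are conjugate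
    under G, so their orbits coincide. *)
Lemma inverse_pair_self_dual E x y (hE : euler_operator E) :
  inverse_pair E x y -> self_dual E.
Proof.
move=> hxy; have [gx gy _] := hxy; have meet := inverse_pair_meet hE hxy.
have Gx : elementary_group E (exp_ad x) by apply: gen_in; exists x => //; left.
have Gy : elementary_group E (exp_ad y) by apply: gen_in; exists y => //; right.
have Kx := exp_ad_cancel hE (or_introl gx).
have Ky := exp_ad_cancel hE (or_intror gy).
have GNx : elementary_group E (exp_ad (- x)).
  by apply: gen_in; exists (- x) => //; left; apply: grade_oppr_closed.
have GNy : elementary_group E (exp_ad (- y)).
  by apply: gen_in; exists (- y) => //; right; apply: grade_oppr_closed.
split; last first.
  by exists (flag_act (exp_ad x) (flag_minus E)); split; [exists x | exists y].
apply/seteqP; split=> _ [f Gf <-].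
  exists (f \o (exp_ad (- x) \o exp_ad y)).
    by apply: gen_comp => //; apply: gen_comp.
  rewrite -(flag_act_comp f) -(flag_act_comp (exp_ad _)) -meet.
  by rewrite (flag_act_cancel _ Kx).
exists (f \o (exp_ad (- y) \o exp_ad x)).
  by apply: gen_comp => //; apply: gen_comp.
rewrite -(flag_act_comp f) -(flag_act_comp (exp_ad _)) meet.
by rewrite (flag_act_cancel _ Ky).
Qed.

(** * The Jordan algebra of an inverse pair *)

(** The Jordan identity of the product [[a, y], b] / 2 in Lie form: with
    d = [a, y], it says that ad d commutes on g_1 with ad [[d, a], y].
    Put p = [d, a], q = [d, y], z = [p, y] = - [a, q] and w = [d, z].  The first
    expression for z gives w = [[d, p], y] + [p, q]; the second gives
    - w = [p, q] + [a, [d, q]], where [a, [d, q]] = w + [[d, p], y] because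
    [d, q] = [y, z].  Adding up, 3w = 0. *)
Lemma jordan_commute E a y (hE : euler_operator E) :
    grade E 1 a -> grade E (- 1) y ->
  lie (lie a y) (lie (lie (lie a y) a) y) = 0.
Proof.
move=> ga gy; have gD := grade_lie0 ga gy.
(* Opaque names keep Leibniz rewriting from unfolding nested brackets. *)
have [d Dd] : exists d, lie a y = d by exists (lie a y).
rewrite Dd in gD *.
have [p dp] : exists p, lie d a = p by exists (lie d a).
have [q dq] : exists q, lie d y = q by exists (lie d y).
have gp : grade E 1 p by rewrite -dp; apply: grade_lier.
have gq : grade E (- 1) q by rewrite -dq; apply: grade_lier.
rewrite dp; set z := lie p y; set w := lie d z.
have zE : z = - lie a q.
  apply/eqP; rewrite -addr_eq0 -[X in _ == X](liexx d) -{2}Dd.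
  by rewrite lie_leibniz dp dq.
have yz : lie y z = lie d q.
  rewrite zE lieNr lie_leibniz (lieC y a) Dd lieNl.
  rewrite (_ : lie y q = 0) ?lie0r ?addr0 ?opprK //.
  exact: (grade_lieN1N1 hE).
have az : lie a z = - lie d p.
  by rewrite lie_leibniz (grade_lie11 hE ga gp) lie0l add0r Dd lieC.
have adq : lie a (lie d q) = w + lie (lie d p) y.
  by rewrite -yz lie_leibniz Dd az lieNr -lieC.
have w1 : w = lie (lie d p) y + lie p q by rewrite /w /z lie_leibniz dq.
have w2 : - w = lie p q + (w + lie (lie d p) y).
  by rewrite -adq {1}/w zE lieNr opprK lie_leibniz dp.
apply: (mulrn_unit_eq0 three_unit).
transitivity (w + (lie p q + (w + lie (lie d p) y))); last by rewrite -w2 subrr.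
rewrite mulrS mulr2n [lie p q + _]addrCA; congr (w + (w + _)).
by rewrite w1 addrC.
Qed.

(** The difference is [[a, b], y], and [a, b] lies in degree 2. *)
Lemma homotope_comm E a b y (hE : euler_operator E) :
  grade E 1 a -> grade E 1 b -> lie (lie a y) b = lie (lie b y) a.
Proof.
move=> ga gb.
by rewrite lieC lie_leibniz (grade_lie11 hE gb ga) lie0l add0r -lieC.
Qed.

(** With a.b = [[a, y], b] / 2 and L its left multiplications, the left-hand side
    acts on g_1 as 4 (L(a.b) + [L(a), L(b)]), and L(a.b) + [L(a), L(b)] is half
    the operator c -> {a, b, c} of the Jordan triple product. *)
Lemma homotope_triple E a b y (hE : euler_operator E) :
    grade E 1 a -> grade E 1 b ->
  lie (lie (lie a y) b) y + lie (lie a y) (lie b y) = - lie a (lie y (lie y b)).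
Proof.
move=> ga gb; rewrite (homotope_comm y hE ga gb).
rewrite (lieC y (lie y b)) (lieC y b) lieNl opprK.
rewrite (lieC (lie a y)) (lie_leibniz (lie b y)) opprD addrA.
by rewrite subrr sub0r.
Qed.

End ThreeGrading.

Section JordanAlgebra.
Variables (K : comUnitRingType) (g : lieAlgType K) (E : g).

(** A boolean form of membership in g_1, from which the submodule g_1 is built
    as a type. *)
Definition grade1_pred : {pred g} := [pred u | lie E u == u].

Fact grade1_submod_closed : submod_closed grade1_pred.
Proof.
split=> [|k u v]; rewrite !inE ?lie0r // => /eqP uE /eqP vE.
by rewrite lieDr lieZr uE vE.
Qed.

HB.instance Definition _ :=
  GRing.isSubmodClosed.Build K g grade1_pred grade1_submod_closed.

Record grade1_module :=
  Grade1 { grade1_val : g; _ : grade1_val \in grade1_pred }.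

HB.instance Definition _ := [isSub for grade1_val].
HB.instance Definition _ := [Choice of grade1_module by <:].
HB.instance Definition _ := [SubChoice_isSubLmodule of grade1_module by <:].

Lemma grade1_valP (a : grade1_module) : grade E 1 (val a).
Proof. exact/grade1E/eqP/(valP a). Qed.

Lemma grade1_predP u : grade E 1 u -> u \in grade1_pred.
Proof. by move=> /grade1E uE; rewrite inE uE. Qed.

Hypothesis two_unit : (2%:R : K) \is a GRing.unit.
Hypothesis three_unit : (3%:R : K) \is a GRing.unit.
Hypothesis hE : euler_operator E.
Variables x y : g.
Hypothesis hxy : inverse_pair E x y.

Local Notation half := ((2%:R : K)^-1).

Fact homotope_closed (a b : grade1_module) :
  half *: lie (lie (val a) y) (val b) \in grade1_pred.
Proof.
have [_ gy _] := hxy; apply/grade1_predP/grade_scaler_closed.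
by apply: grade_lier (grade1_valP b); apply: grade_lie0 gy; apply: grade1_valP.
Qed.

(** The product of the homotope of the Jordan pair at - y, the Jordan inverse
    of x. *)
Definition homotope_mul (a b : grade1_module) : grade1_module :=
  Grade1 (homotope_closed a b).

Fact homotope_unit_closed : x \in grade1_pred.
Proof. by have [gx _ _] := hxy; apply: grade1_predP. Qed.

Definition homotope_one : grade1_module := Grade1 homotope_unit_closed.

Fact homotope_mul_linear (b : grade1_module) : linear (homotope_mul^~ b).
Proof.
move=> k a a'; apply: val_inj; rewrite /= !(lieDl, lieZl) scalerDr.
by rewrite !scalerA mulrC.
Qed.

Fact homotope_mulC : commutative homotope_mul.
Proof.
move=> a b; apply: val_inj => /=; congr (_ *: _).
by apply: (homotope_comm two_unit three_unit y hE); apply: grade1_valP.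
Qed.

Fact homotope_mul1 : left_id homotope_one homotope_mul.
Proof.
move=> a; apply: val_inj => /=; have [_ _ ->] := hxy.
by rewrite (iffLR (grade1E _ _) (grade1_valP a)) halfK.
Qed.

(** Leibniz reduces the identity to the vanishing of [d, [[d, a], y]]. *)
Fact homotope_jordan (a b : grade1_module) :
  homotope_mul a (homotope_mul (homotope_mul a a) b) =
  homotope_mul (homotope_mul a a) (homotope_mul a b).
Proof.
apply: val_inj => /=; have [_ gy _] := hxy.
set d := lie (val a) y.
rewrite !(lieZl, lieZr) lie_leibniz.
rewrite (jordan_commute two_unit three_unit hE (grade1_valP a) gy).
by rewrite lie0l add0r.
Qed.

HB.instance Definition _ := Lmodule_isUnitalJordanAlgebra.Build K grade1_module
  homotope_mul_linear homotope_mulC homotope_mul1 homotope_jordan.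

Definition homotope_algebra : unitalJordanAlgType K := grade1_module.

Definition homotope_plus (a : homotope_algebra) : g := grade1_val a.
Definition homotope_minus (a : homotope_algebra) : g := weyl x y (grade1_val a).

Fact homotope_plus_linear : linear homotope_plus.
Proof. by []. Qed.

Fact homotope_minus_linear : linear homotope_minus.
Proof. by move=> k a b; rewrite /homotope_minus -weyl_linear. Qed.

HB.instance Definition _ := GRing.isLinear.Build K homotope_algebra g *:%R
  homotope_plus homotope_plus_linear.
HB.instance Definition _ := GRing.isLinear.Build K homotope_algebra g *:%R
  homotope_minus homotope_minus_linear.

Lemma homotope_plus_triple (a b c : homotope_algebra) :
  homotope_plus (jordan_triple a b c) =
  lie_triple (homotope_plus a) (homotope_minus b) (homotope_plus c).
Proof.
have [ga gb] := (grade1_valP a, grade1_valP b).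
rewrite /lie_triple /homotope_minus (weyl1 two_unit three_unit hE hxy gb).
rewrite /jordan_triple raddfMn /= /homotope_plus !(lieZl, lieZr).
rewrite -!scalerDr -!scalerBr scalerMnr halfK // -scalerN; congr (_ *: _).
rewrite (lie_leibniz (lie (grade1_val a) y)) addrA addrK -lieDl.
rewrite (homotope_triple two_unit three_unit y hE ga gb).
exact: lieNl.
Qed.

(** The second triple identity is the image of the first one under the
    automorphism w, since w composed with the second map is the inclusion. *)
Lemma homotope_pair_iso : jordan_pair_iso E homotope_plus homotope_minus.
Proof.
have [[_ _ wlie] ww w1 wN1 _] :=
  weyl_graded_involution two_unit three_unit hE hxy.
split.
- split=> [a _|a b _ _|u gu]; first exact: grade1_valP.
    exact: val_inj.
  by exists (Grade1 (grade1_predP gu)).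
- split=> [a _|a b _ _ /(can_inj ww)|v].
  + by rewrite -w1; exists (val a) => //; apply: grade1_valP.
  + exact: val_inj.
  + rewrite -w1 => -[u gu <-].
    by exists (Grade1 (grade1_predP gu)).
- exact: homotope_plus_triple.
move=> a b c.
transitivity (weyl x y (homotope_plus (jordan_triple a b c))); first by [].
rewrite homotope_plus_triple /lie_triple.
have wN t : weyl x y (- t) = - weyl x y t.
  by rewrite /weyl /= !raddfN.
by rewrite wN !wlie /homotope_minus ww.
Qed.

End JordanAlgebra.

(** The triple product {1, b, 1} is 2b, so Q of the image of 1 is the composite
    of one isomorphism with the inverse of the other. *)
Lemma jordan_pair_iso_invertible (K : comUnitRingType) (g : lieAlgType K)
    (E : g) (J : unitalJordanAlgType K) (hp hm : {linear J -> g}) :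
  (2%:R : K) \is a GRing.unit -> jordan_pair_iso E hp hm ->
  invertible_plus E (hp jone).
Proof.
move=> two_unit [[hpf hpI hpS] [hmf hmI hmS] hpT _].
have Q1 b : lie_quad (hp jone) (hm b) = hp b.
  rewrite /lie_quad -[RHS](halfK two_unit); congr (_ *: _).
  have := hpT jone b jone; rewrite /lie_triple -lieC => <-.
  have j1 c : jmul c jone = c :> J by rewrite jmulC jmul1.
  by rewrite /jordan_triple !jmul1 !j1 addrK raddfMn.
split; first exact: hpf.
split=> [v gv|v v'|u gu].
- by have [b _ <-] := hmS v gv; rewrite Q1; apply: hpf.
- rewrite !inE => /hmS[b _ <-] /hmS[b' _ <-]; rewrite !Q1.
  by move=> /hpI ->; rewrite ?inE.
- by have [b _ <-] := hpS u gu; exists (hm b); [apply: hmf | apply: Q1].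
Qed.

(** * The equivalence *)

Theorem theorem5p5 (K : comUnitRingType)
    (two_unit : (2%:R : K) \is a GRing.unit)
    (three_unit : (3%:R : K) \is a GRing.unit)
    (g : lieAlgType K) (E : g) (hE : euler_operator E) :
  [<-> self_dual E;
       exists j : g -> g, graded_involution E j /\
         (flag_act j @` V_plus E) `&` V_plus E !=set0;
       (exists x : g, invertible_plus E x) \/
         (exists y : g, invertible_minus E y);
       exists (J : unitalJordanAlgType K) (hp hm : {linear J -> g}),
         jordan_pair_iso E hp hm].
Proof.
tfae.
- move=> [_ meet].
  have [x xinv] := V_meet_invertible two_unit meet.
  have [y hxy] := invertible_inverse_pair two_unit three_unit hE xinv.
  have hj := weyl_graded_involution two_unit three_unit hE hxy.
  by exists (weyl x y); split=> //; rewrite (graded_involution_V hj) setIC.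
- move=> [j [hj]]; rewrite (graded_involution_V hj) setIC => meet.
  by left; apply: V_meet_invertible.
- have iso x y : inverse_pair E x y -> exists (J : unitalJordanAlgType K)
      (hp hm : {linear J -> g}), jordan_pair_iso E hp hm.
    move=> hxy; do 3!eexists.
    exact: (homotope_pair_iso two_unit three_unit hE hxy).
  case=> [[x xinv]|[y [gy Qy]]].
    by have [y /iso] := invertible_inverse_pair two_unit three_unit hE xinv.
  (* For - E the two halves of the Jordan pair are exchanged. *)
  have yinv : invertible_plus (- E) y by split; rewrite !gradeN ?opprK.
  have [x] :=
    invertible_inverse_pair two_unit three_unit (euler_operatorN hE) yinv.
  by move=> /inverse_pairC; rewrite opprK => /iso.
- move=> [J [hp [hm /(jordan_pair_iso_invertible two_unit) xinv]]].
  have [y hxy] := invertible_inverse_pair two_unit three_unit hE xinv.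
  exact: inverse_pair_self_dual hxy.
Qed.
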